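(* Let $L$ be an Archimedean vector lattice and $\mathcal{T}$ a maximal multi-truncation on $L$. Then the map $\Lambda:L\to C^{\infty}(\mathcal{V})$ defined by $\Lambda(f)=\widehat{f}$ for all $f\in L$ is a one-to-one lattice homomorphism such that $$\Lambda(f^{\ast})=1_{\mathcal{V}^{\ast}}\wedge\Lambda(f)\quad\text{for all }\ast\in\mathcal{T}\text{ and }f\in L^{+}.$$
   Context: All vector lattices are real; $L^{+}$ is the positive cone of $L$. $L$ is Archimedean if $f,g\in L^{+}$ and $nf\leq g$ for all $n\in\{1,2,\dots\}$ imply $f=0$. A truncation on $L$ is a nonzero function (not identically zero) $L^{+}\to L^{+}$, $f\mapsto f^{\ast}$, such that (a) $f\wedge g^{\ast}\leq f^{\ast}\leq f$ for all $f,g\in L^{+}$; and (b) if $f\in L^{+}$ and $(nf)^{\ast}=nf$ for all $n\in\{1,2,\dots\}$, then $f=0$. A multi-truncation on $L$ is a family $\mathcal{T}$ of truncations on $L$ such that $f^{\ast}\wedge f^{\rtimes}=0$ for all $f\in L^{+}$ and all $\ast,\rtimes\in\mathcal{T}$ with $\ast\neq\rtimes$. It is maximal if it is not strictly contained in another multi-truncation on $L$. An ideal of $L$ is a vector subspace $P$ such that $f\in P$, $g\in L$, $|g|\leq|f|$ imply $g\in P$; it is prime if $f\wedge g\in P$ implies $f\in P$ or $g\in P$. $\mathcal{P}$ is the set of all proper prime ideals of $L$. For $f\in L$, $\mathrm{Val}(f)$ is the set of values of $f$, i.e. of those $P\in\mathcal{P}$ which are maximal with respect to not containing $f$. Put $\mathcal{V}^{\ast}=\bigcup_{f\in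 L^{+}}\mathrm{Val}(f^{\ast})$ for $\ast\in\mathcal{T}$ and $\mathcal{V}=\bigcup_{\ast\in\mathcal{T}}\mathcal{V}^{\ast}$ (the sets $\mathcal{V}^{\ast}$ are pairwise disjoint). $\mathcal{V}$ carries the hull-kernel topology, with base the sets $\{P\in\mathcal{V}:f\notin P\}$, $f\in L^{+}$. For $f\in L$, the function $\widehat{f}:\mathcal{V}\to\overline{\mathbb{R}}=[-\infty,\infty]$ is defined as follows: for $P\in\mathcal{V}$ let $\ast$ be the unique element of $\mathcal{T}$ with $P\in\mathcal{V}^{\ast}$, choose an arbitrary $u$ in $\pi^{\ast}(P)=\{v\in L^{+}:(v-v^{\ast})^{\ast}\notin P\}$, and put $\widehat{f}(P)=\inf\{\alpha\in\mathbb{R}:(f-\alpha u^{\ast})^{+}\in P\}$, with $\inf\mathbb{R}=-\infty$ and $\inf\emptyset=\infty$ (the value does not depend on the choice of $u\in\pi^{\ast}(P)$). For a topological space $X$, $C^{\infty}(X)$ is the set of all continuous $\varphi:X\to\overline{\mathbb{R}}$ such that $\{x:|\varphi(x)|\neq\infty\}$ is dense in $X$, with the pointwise ordering. For $\varphi,\psi,\chi\in C^{\infty}(X)$, $\chi=\varphi+\psi$ means $\chi(x)=\varphi(x)+\psi(x)$ wherever $\varphi(x),\psi(x)$ are both finite. A lattice homomorphism into $C^{\infty}(X)$ is a map that is linear (in this sense of addition) and preserves finite suprema and infima. $1_{D}$ is the characteristic function of $D$.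
   Formalization: The formal theorem assumes that π*(P) is nonempty for every * in T and P in V*, i.e. that every f̂ is defined; this can fail (continuous piecewise polynomials on [0,1] vanishing at 0, f* = f∧1, P = {f : f'(0) = 0}), and then f̂(P) is undefined. *)

(* Defs.v *)
From HB Require Import structures.
From mathcomp Require Import all_boot all_order all_algebra.
From mathcomp Require Import all_classical all_reals all_analysis.

Set Implicit Arguments.
Unset Strict Implicit.
Unset Printing Implicit Defensive.

Import Order.TTheory GRing.Theory Num.Theory.
Local Open Scope classical_set_scope.
Local Open Scope ring_scope.

(** * Vector lattices *)

(* The lattice operations are fields of the mixin, and Order.Lattice is then an
   instance on every vector lattice, because the hierarchy has no common
   ancestor of Num.RealDomain that is both a Zmodule and a lattice. *)
HB.mixin Record POrder_Lmodule_isVectorLattice (R : realType) L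
    & GRing.Lmodule R L & Num.POrderedZmodule L := {
  vl_inf : L -> L -> L ;
  vl_sup : L -> L -> L ;
  vl_infP : forall f g h : L, (f <= vl_inf g h) = (f <= g) && (f <= h) ;
  vl_supP : forall f g h : L, (vl_sup f g <= h) = (f <= h) && (g <= h) ;
  vl_leD2r : forall f g h : L, f <= g -> f + h <= g + h ;
  vl_scale_ge0 : forall (a : R) (f : L), 0 <= a -> 0 <= f -> 0 <= a *: f }.

#[short(type="vectorLatticeType")]
HB.structure Definition VectorLattice (R : realType) :=
  { L of GRing.Lmodule R L & Num.POrderedZmodule L
      & POrder_Lmodule_isVectorLattice R L }.

HB.instance Definition _ (R : realType) (L : vectorLatticeType R) :=
  Order.POrder_MeetJoin_isLattice.Build ring_display (VectorLattice.sort L)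
    (@vl_infP R L) (@vl_supP R L).

(* In ring_scope the lattice operations of L are written through %O, since
   classical_set_scope uses the same symbols for sets. *)

Section VectorLatticeDefs.
Context {R : realType} {L : vectorLatticeType R}.

Definition vabs (f : L) : L := (f `|` - f)%O.

Record posCone := PosCone { poscone_val :> L ; _ : 0 <= poscone_val }.

HB.instance Definition _ := [isSub for poscone_val].
HB.instance Definition _ := [Choice of posCone by <:].

Lemma posCone_ge0 (f : posCone) : 0 <= (f : L).
Proof. by case: f. Qed.

HB.instance Definition _ := isPointed.Build posCone (PosCone (lexx (0 : L))).

Lemma pospart_subproof (f : L) : 0 <= (f `|` 0)%O.
Proof. exact: leUr. Qed.

(* The positive part $f^+$. As it fixes $L^+$, it also serves to regard an
   element of L that is known to be positive as an element of posCone. *)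
Definition pospart (f : L) : posCone := PosCone (pospart_subproof f).

Lemma pospart_id (f : L) : 0 <= f -> pospart f = f :> L.
Proof. by move=> f0; exact: join_l. Qed.

Lemma vabs_ge0_id (f : L) : 0 <= f -> vabs f = f.
Proof.
move=> f0; apply: join_l; apply: (le_trans _ f0).
by have := vl_leD2r 0 f (- f) f0; rewrite add0r subrr.
Qed.

Lemma vabs_ge0 (f : L) : 0 <= vabs f.
Proof.
have h0 : 0 <= vabs f + vabs f.
  have hp : f <= vabs f by exact: leUl.
  have hn : - f <= vabs f by exact: leUr.
  rewrite -(subrr f); apply: le_trans (vl_leD2r _ _ (vabs f) hp).
  by rewrite ![f + _]addrC; exact: vl_leD2r.
have := vl_scale_ge0 2^-1 _ _ h0.
rewrite -mulr2n -[vabs f *+ 2]scaler_nat scalerA mulVf ?pnatr_eq0// scale1r.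
by apply; rewrite invr_ge0 ler0n.
Qed.

Definition archimedean := forall f g : posCone,
  (forall n : nat, (f : L) *+ n.+1 <= (g : L)) -> (f : L) = 0.

(** * Truncations *)

Definition truncation (s : posCone -> posCone) :=
  [/\ exists f : posCone, (s f : L) != 0,
      forall f g : posCone,
        ((f : L) `&` (s g : L))%O <= (s f : L) /\ (s f : L) <= (f : L)
    & forall f : posCone,
        (forall n, (s (pospart ((f : L) *+ n.+1)) : L) = (f : L) *+ n.+1) ->
        (f : L) = 0].

Definition multitruncation (T : set (posCone -> posCone)) :=
  T `<=` truncation /\
  forall s t, T s -> T t -> s <> t ->
    forall f : posCone, ((s f : L) `&` (t f : L))%O = 0.

Definition maximal_multitruncation (T : set (posCone -> posCone)) :=
  multitruncation T /\ ~ exists2 T', multitruncation T' & T `<` T'.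

(** * Prime ideals and values *)

Definition videal (P : set L) :=
  [/\ P 0, forall f g, P f -> P g -> P (f + g),
      forall (a : R) f, P f -> P (a *: f)
    & forall f g, P f -> vabs g <= vabs f -> P g].

Definition prime_videal (P : set L) :=
  videal P /\ forall f g, P (f `&` g)%O -> P f \/ P g.

Definition proper_prime_videals : set (set L) :=
  [set P | prime_videal P /\ P != setT].

Definition Val (f : L) : set (set L) :=
  [set P | [/\ proper_prime_videals P, ~ P f
             & forall Q, proper_prime_videals Q -> ~ Q f -> P `<=` Q -> P = Q]].

Definition Vstar (s : posCone -> posCone) : set (set L) :=
  \bigcup_(f in [set: posCone]) Val (s f).

Definition Vset (T : set (posCone -> posCone)) : set (set L) :=
  \bigcup_(s in T) Vstar s.

Definition spectrum (T : set (posCone -> posCone)) : Type := set_type (Vset T).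

End VectorLatticeDefs.

Arguments posCone {R} L.
Arguments archimedean {R} L.

(** * The hull-kernel topology *)

Section HullKernel.
Context {R : realType} {L : vectorLatticeType R}.
Variable T : set (posCone L -> posCone L).

HB.instance Definition _ := Choice.on (spectrum T).

Definition hk_base (f : posCone L) : set (spectrum T) :=
  [set P | ~ \val P (f : L)].

Lemma spectrum_prime (P : spectrum T) : proper_prime_videals (\val P).
Proof. by case: P => P /= /set_mem[s _ [f _ []]]. Qed.

Lemma hk_base_cover : \bigcup_(f in [set: posCone L]) hk_base f = setT.
Proof.
apply/seteqP; split=> // P _; have [[[P0 _ _ Ps] _] PT] := spectrum_prime P.
have [f Pf] : exists f, ~ \val P f.
  by apply/existsNP => PA; move/eqP: PT; apply; apply/seteqP; split.
exists (PosCone (vabs_ge0 f)) => //= Paf; apply: Pf; apply: Ps Paf _.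
by rewrite (vabs_ge0_id (vabs_ge0 f)).
Qed.

Lemma hk_base_join (f g : posCone L) (P : spectrum T) :
  setT f -> setT g -> hk_base f P -> hk_base g P ->
  exists h, [/\ setT h, hk_base h P & hk_base h `<=` hk_base f `&` hk_base g].
Proof.
move=> _ _ Pf Pg.
have h0 : 0 <= ((f : L) `&` (g : L))%O by rewrite lexI !posCone_ge0.
exists (PosCone h0); split=> //.
  by have [[_ Pp] _] := spectrum_prime P; move=> /Pp[].
move=> Q /= Qh; have [[[_ _ _ Qs] _] _] := spectrum_prime Q.
by split=> Qk; apply: Qh; apply: Qs Qk _; rewrite !vabs_ge0_id ?posCone_ge0//;
  [exact: leIl|exact: leIr].
Qed.

HB.instance Definition _ :=
  isBaseTopological.Build (spectrum T) hk_base_cover hk_base_join.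

(* $\mathcal{V}^{\ast}$ as a subset of the space $\mathcal{V}$ *)
Definition Vstar_in (s : posCone L -> posCone L) : set (spectrum T) :=
  [set P | Vstar s (\val P)].

Definition pistar (s : posCone L -> posCone L) (P : set L) : set (posCone L) :=
  [set v : posCone L | ~ P (s (pospart ((v : L) - (s v : L))))].

Definition hat_val (s : posCone L -> posCone L) (u : posCone L) (f : L)
    (P : set L) : \bar R :=
  ereal_inf [set a%:E | a in [set a : R | P (pospart (f - a *: (s u : L)))]].

(* phi is the function $\widehat f$, for some choice of the elements u.
   This is a relation rather than a function of f because pistar s P can be
   empty for P in Vstar s, so that there is nothing to choose u from. An
   example is $f^{\ast} = f \wedge 1$ on the continuous piecewise polynomial
   functions on [0, 1] vanishing at 0, with P = {f | f'(0) = 0}. *)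
Definition is_hat (f : L) (phi : spectrum T -> \bar R) :=
  forall (P : spectrum T) (s : posCone L -> posCone L), T s -> Vstar_in s P ->
    exists2 u : posCone L, pistar s (\val P) u & phi P = hat_val s u f (\val P).

End HullKernel.

Arguments Vstar_in {R L} T s.

(** * The lattice $C^{\infty}(X)$ *)

Section Cinf.
Context (R : realType) (X : topologicalType).

Definition cinf_set : set (X -> \bar R) :=
  [set phi | continuous phi /\ dense [set x | `|phi x|%E != +oo%E]].

Record Cinf := MkCinf {
  cinf_fun :> X -> \bar R ;
  _ : cinf_fun \in cinf_set }.

HB.instance Definition _ := [isSub for cinf_fun].
HB.instance Definition _ := [Choice of Cinf by <:].

Lemma cinf_open (phi : X -> \bar R) : continuous phi ->
  open [set x | `|phi x|%E != +oo%E].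
Proof.
move=> cphi.
have -> : [set x | `|phi x|%E != +oo%E] =
    phi @^-1` ([set y | -oo < y]%E `&` [set y | y < +oo]%E).
  apply/seteqP; split=> x /=; case: (phi x) => [r| |] //=.
  - by move=> _; split; [exact: ltNyr|exact: ltry].
  - by case.
  - by case.
apply: open_comp; first by move=> x _; exact: cphi.
by apply: openI; [exact: open_ereal_gt_ereal|exact: open_ereal_lt_ereal].
Qed.

Lemma cinf_min_subproof (phi psi : Cinf) : (phi \min psi) \in cinf_set.
Proof.
case: phi psi => phi /= /set_mem[cphi dphi] [psi /= /set_mem[cpsi dpsi]].
apply/mem_set; split; first exact: min_fun_continuous.
move=> O O0 oO; have [x [Ox [fx gx]]] := denseI (cinf_open cphi) dphi dpsi O0 oO.
by exists x; split=> //=; rewrite minEle; case: ifP.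
Qed.

Lemma cinf_max_subproof (phi psi : Cinf) : (phi \max psi) \in cinf_set.
Proof.
case: phi psi => phi /= /set_mem[cphi dphi] [psi /= /set_mem[cpsi dpsi]].
apply/mem_set; split; first exact: max_fun_continuous.
move=> O O0 oO; have [x [Ox [fx gx]]] := denseI (cinf_open cphi) dphi dpsi O0 oO.
by exists x; split=> //=; rewrite maxEle; case: ifP.
Qed.

Definition cinf_le (phi psi : Cinf) : bool :=
  `[< forall x, (phi x <= psi x)%E >].
Definition cinf_meet (phi psi : Cinf) : Cinf :=
  MkCinf (cinf_min_subproof phi psi).
Definition cinf_join (phi psi : Cinf) : Cinf :=
  MkCinf (cinf_max_subproof phi psi).

Lemma cinf_le_refl : reflexive cinf_le.
Proof. by move=> phi; apply/asboolP. Qed.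

Lemma cinf_le_anti : antisymmetric cinf_le.
Proof.
move=> phi psi /andP[/asboolP h1 /asboolP h2]; apply/val_inj/funext => x /=.
by apply/eqP; rewrite eq_le h1 h2.
Qed.

Lemma cinf_le_trans : transitive cinf_le.
Proof.
move=> psi phi chi /asboolP h1 /asboolP h2; apply/asboolP => x.
exact: le_trans (h1 x) (h2 x).
Qed.

Fact cinf_display : Order.disp_t. Proof. exact. Qed.

HB.instance Definition _ := Order.Le_isPOrder.Build cinf_display Cinf
  cinf_le_refl cinf_le_anti cinf_le_trans.

Lemma cinf_meetP (phi psi chi : Cinf) :
  (phi <= cinf_meet psi chi)%O = (phi <= psi)%O && (phi <= chi)%O.
Proof.
apply/asboolP/andP => [h|[/asboolP h1 /asboolP h2] x /=].
  by split; apply/asboolP => x; have := h x; rewrite /= le_min => /andP[].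
by rewrite le_min h1 h2.
Qed.

Lemma cinf_joinP (phi psi chi : Cinf) :
  (cinf_join phi psi <= chi)%O = (phi <= chi)%O && (psi <= chi)%O.
Proof.
apply/asboolP/andP => [h|[/asboolP h1 /asboolP h2] x /=].
  by split; apply/asboolP => x; have := h x; rewrite /= ge_max => /andP[].
by rewrite ge_max h1 h2.
Qed.

HB.instance Definition _ := Order.POrder_MeetJoin_isLattice.Build
  cinf_display Cinf cinf_meetP cinf_joinP.

(* $\chi = \varphi + \psi$ *)
Definition cinf_add (phi psi chi : Cinf) :=
  forall x, phi x \is a fin_num -> psi x \is a fin_num ->
    chi x = (phi x + psi x)%E.

(* $\psi = a \varphi$; in \bar R, 0 times an infinite value is 0. *)
Definition cinf_scale (a : R) (phi psi : Cinf) :=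
  forall x, psi x = (a%:E * phi x)%E.

Definition cinf_lattice_hom (L : vectorLatticeType R) (F : L -> Cinf) :=
  [/\ forall f g, cinf_add (F f) (F g) (F (f + g)),
      forall a f, cinf_scale a (F f) (F (a *: f)),
      {morph F : f g / (f `|` g)%O >-> (f `|` g)%O}
    & {morph F : f g / (f `&` g)%O >-> (f `&` g)%O}].

End Cinf.

(* Main.v *)
Require Import Defs.
From mathcomp Require Import all_boot all_order all_algebra.
From mathcomp Require Import all_classical all_reals all_analysis.
From mathcomp Require Import lra.

Set Implicit Arguments.
Unset Strict Implicit.
Unset Printing Implicit Defensive.

Import Order.TTheory GRing.Theory Num.Theory.
Local Open Scope classical_set_scope.
Local Open Scope ring_scope.

(** Let P be a point of the spectrum. Since P is prime, $L/P$ is totally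
    ordered, and the lemma behind everything is that an element u of
    $\pi^{\ast}(P)$ makes $u^{\ast}$ the largest element of the range of the
    truncation $\ast$ in $L/P$ ([trunc_le_pistar]). So the image of $u^{\ast}$
    in $L/P$ is positive and depends on P only, and $\widehat f(P)$ is the
    quotient of f by this element in $L/P$, up to infinitesimals
    ([mod_ratio], [hat_ratio]). Such quotients are unique and respect the linear
    and lattice operations of the totally ordered space $L/P$, which gives the
    homomorphism identities pointwise. The formula for $\widehat{f^{\ast}}$ on
    $\mathcal{V}^{\ast}$ comes from $f \wedge u^{\ast} \leq f^{\ast}$ together
    with $f^{\ast} \leq f$ and $f^{\ast} \leq u^{\ast}$ in $L/P$; outside
    $\mathcal{V}^{\ast}$, $f^{\ast}$ belongs to P, because different truncations
    have disjoint ranges.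

    Topology enters through the fact that u stays in $\pi^{\ast}(Q)$ for all Q
    in the base set of $(u - u^{\ast})^{\ast}$. There the same $u^{\ast}$ is the
    unit, and $f < b u^{\ast}$ in $L/Q$, as well as $f > b u^{\ast}$, is an open
    condition on Q ([hat_continuous]).

    Maximality is used to produce points. If $h > 0$, then h meets the range of
    some truncation, since otherwise $f \mapsto f \wedge h$ could be added to
    the family, and the second axiom of truncations then gives $v \leq nh$ with
    $(v - v^{\ast})^{\ast} \neq 0$ ([maximal_cuts]). A value of this element,
    which exists by Zorn's lemma, is a point P of the spectrum with
    $v \in \pi^{\ast}(P)$, so that $v^{\ast}$ is the unit at P and is bounded
    by $nh$. Applied to $h = (nk - |f|)^+$, with n from the Archimedean
    property, this shows that $\widehat f$ is finite on a dense set
    ([hat_dense]); applied to $h = (f - g)^+$, and after moving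
    from P to a nearby point where $\widehat f = \widehat g$ is finite, it shows
    injectivity ([hat_inj_le]). *)

(** * Vector lattices *)

Section VectorLattice.
Context {R : realType} {L : vectorLatticeType R}.
Implicit Types (f g h k : L) (a b : R).

Lemma vl_leD2rE h f g : (f + h <= g + h) = (f <= g).
Proof.
apply/idP/idP => [/(vl_leD2r _ _ (- h))|]; last exact: vl_leD2r.
by rewrite !addrK.
Qed.

Lemma vl_leD f g h k : f <= g -> h <= k -> f + h <= g + k.
Proof.
move=> fg hk; apply: (le_trans (vl_leD2r _ _ h fg)).
by rewrite ![g + _]addrC vl_leD2rE.
Qed.

Lemma vl_addr_ge0 f g : 0 <= f -> 0 <= g -> 0 <= f + g.
Proof. by move=> f0 g0; rewrite -[leLHS]addr0 vl_leD. Qed.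

Lemma vl_subr_ge0 f g : (0 <= g - f) = (f <= g).
Proof. by rewrite -[LHS](vl_leD2rE f) add0r subrK. Qed.

Lemma vl_ler_subl f g h : (f - g <= h) = (f <= h + g).
Proof. by rewrite -[LHS](vl_leD2rE g) subrK. Qed.

Lemma vl_leN f g : (- f <= - g) = (g <= f).
Proof. by rewrite -[LHS]vl_subr_ge0 opprK addrC vl_subr_ge0. Qed.

Lemma vl_ge0_leZ a f g : 0 <= a -> f <= g -> a *: f <= a *: g.
Proof.
move=> a0 fg; rewrite -vl_subr_ge0 -scalerBr; apply: vl_scale_ge0 => //.
by rewrite vl_subr_ge0.
Qed.

Lemma vl_mulrn_ge0 n f : 0 <= f -> 0 <= f *+ n.
Proof. by move=> f0; rewrite -scaler_nat; exact: vl_scale_ge0. Qed.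

Lemma vl_lerMn n f g : f <= g -> f *+ n <= g *+ n.
Proof.
by move=> fg; rewrite -vl_subr_ge0 -mulrnBl vl_mulrn_ge0 ?vl_subr_ge0.
Qed.

Lemma vl_meetDr f g h : (f `&` g)%O + h = ((f + h) `&` (g + h))%O.
Proof.
apply/eqP; rewrite eq_le lexI !vl_leD2rE leIl leIr/=.
by rewrite -vl_ler_subl lexI !vl_ler_subl leIl leIr.
Qed.

Lemma vl_pos_sub f g : ((f - g) `|` 0)%O = f - (f `&` g)%O.
Proof.
apply/eqP; rewrite eq_le; apply/andP; split.
  by rewrite leUx vl_subr_ge0 leIl andbT vl_leD ?vl_leN ?leIr.
rewrite vl_ler_subl addrC -vl_ler_subl lexI !vl_ler_subl.
rewrite -[leLHS]addr0 vl_leD ?leUr//=.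
by rewrite addrC -vl_ler_subl leUl.
Qed.

Lemma vl_pos_sub_disjoint f g : (((f - g) `|` 0) `&` ((g - f) `|` 0))%O = 0.
Proof. by rewrite !vl_pos_sub (meetC g f) -vl_meetDr subrr. Qed.

Lemma vl_meet_le0_mulrn f g n :
  0 <= f -> 0 <= g -> (f `&` g)%O <= 0 -> (f `&` (g *+ n))%O <= 0.
Proof.
move=> f0 g0 fg; elim: n => [|n IHn]; first by rewrite mulr0n leIr.
apply: (le_trans _ IHn); rewrite lexI leIl/= -[g *+ n]add0r -vl_ler_subl.
apply: le_trans fg; rewrite lexI !vl_ler_subl; apply/andP; split.
  apply: (le_trans (leIl _ _)); rewrite -[leLHS]addr0.
  by apply: vl_leD => //; exact: vl_mulrn_ge0.
by apply: (le_trans (leIr _ _)); rewrite mulrS.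
Qed.

Lemma vabs_le f g : (vabs f <= g) = (f <= g) && (- f <= g).
Proof. exact: leUx. Qed.

Lemma pospart_ge0 f : 0 <= (pospart f : L).
Proof. exact: posCone_ge0. Qed.

Lemma pospart_eq0 f g : ((pospart (f - g) : L) == 0) = (f <= g).
Proof.
by rewrite eq_le pospart_ge0 andbT /= leUx lexx andbT vl_ler_subl add0r.
Qed.

End VectorLattice.
#[local] Hint Extern 0 (is_true (@Order.le _ _ _ (poscone_val _))) =>
  exact: posCone_ge0 : core.

(** * The total preorder modulo a prime ideal *)

Section Ideal.
Context {R : realType} {L : vectorLatticeType R}.
Variable P : set L.
Hypothesis idealP : videal P.
Implicit Types (f g h : L) (a b : R).

Lemma videal_solid f g : P g -> 0 <= f -> f <= g -> P f.
Proof.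
case: idealP => _ _ _ S Pg f0 fg; apply: S Pg _.
by rewrite !vabs_ge0_id//; exact: le_trans fg.
Qed.

Lemma videal_mulrn n f : P f -> P (f *+ n).
Proof. by case: idealP => _ _ S _ Pf; rewrite -scaler_nat; exact: S. Qed.

(** $f \leq g$ in the quotient $L/P$. *)
Definition mod_le f g := P (pospart (f - g)).

Lemma le_mod_le f g : f <= g -> mod_le f g.
Proof.
by rewrite /mod_le -pospart_eq0 => /eqP ->; case: idealP.
Qed.

Lemma mod_le_trans g f h : mod_le f g -> mod_le g h -> mod_le f h.
Proof.
case: idealP => _ D _ _ fg gh; apply: (videal_solid (D _ _ fg gh)) => //.
rewrite /= leUx -(subrKA g) vl_leD ?leUl//=.
by rewrite -[leLHS]addr0 vl_leD ?leUr.
Qed.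

Lemma mod_leD f g h k : mod_le f g -> mod_le h k -> mod_le (f + h) (g + k).
Proof.
case: idealP => _ D _ _ fg gh; apply: (videal_solid (D _ _ fg gh)) => //.
rewrite /= leUx opprD addrACA vl_leD ?leUl//=.
by rewrite -[leLHS]addr0 vl_leD ?leUr.
Qed.

Lemma mod_leN f g : mod_le f g -> mod_le (- g) (- f).
Proof. by rewrite /mod_le opprK addrC. Qed.

Lemma mod_leZ a f g : 0 <= a -> mod_le f g -> mod_le (a *: f) (a *: g).
Proof.
case: idealP => _ _ S _ a0 /(S a) fg; apply: (videal_solid fg) => //.
by rewrite /= leUx vl_scale_ge0 ?leUr// andbT -scalerBr vl_ge0_leZ// leUl.
Qed.

Lemma mod_leZ_congr a f g :
  mod_le f g -> mod_le g f -> mod_le (a *: f) (a *: g).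
Proof.
move=> fg gf; have [a0|/ltW a0] := leP 0 a; first exact: mod_leZ.
have /mod_leN : mod_le (- a *: g) (- a *: f).
  by apply: mod_leZ; rewrite ?oppr_ge0.
by rewrite !scaleNr !opprK.
Qed.

Lemma mod_le0 f : 0 <= f -> mod_le f 0 <-> P f.
Proof. by move=> f0; rewrite /mod_le subr0 pospart_id. Qed.

Lemma mod_le_join f g h : mod_le (f `|` g)%O h <-> mod_le f h /\ mod_le g h.
Proof.
split=> [fgh|[fh gh]].
  by split; apply: mod_le_trans fgh; apply: le_mod_le;
    [exact: leUl|exact: leUr].
case: idealP => _ D _ _; apply: (videal_solid (D _ _ fh gh)) => //.
rewrite /= leUx vl_ler_subl leUx.
apply/andP; split; last by rewrite -[leLHS]addr0 vl_leD ?leUr.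
apply/andP; split.
  by rewrite -vl_ler_subl -[leLHS]addr0 vl_leD ?leUl ?leUr.
by rewrite -vl_ler_subl -[leLHS]add0r vl_leD ?leUl ?leUr.
Qed.

Hypothesis primeP : forall f g, P (f `&` g)%O -> P f \/ P g.

Lemma mod_le_total f g : mod_le f g \/ mod_le g f.
Proof.
by apply: primeP; rewrite /= vl_pos_sub_disjoint; case: idealP.
Qed.

Lemma mod_le_meet f g h : mod_le (f `&` g)%O h <-> mod_le f h \/ mod_le g h.
Proof.
split=> [fgh|]; last first.
  by case; apply: mod_le_trans; apply: le_mod_le; [exact: leIl|exact: leIr].
suff sub k l : mod_le k l -> mod_le k (k `&` l)%O.
  have [|] := mod_le_total f g => /sub fg; [left|right].
    exact: mod_le_trans fgh.
  by apply: mod_le_trans fgh; rewrite meetC.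
rewrite /mod_le /= vl_pos_sub => kl; rewrite join_l//.
by rewrite vl_subr_ge0 leIl.
Qed.

Lemma le_mod_meet f g h : mod_le h f -> mod_le h g -> mod_le h (f `&` g)%O.
Proof.
move=> hf hg; have /mod_le_meet[] : mod_le (f `&` g)%O (f `&` g)%O.
- exact: le_mod_le.
- exact: mod_le_trans.
- exact: mod_le_trans.
Qed.

End Ideal.

(** * Ratios modulo a prime ideal *)

Lemma lte_fin_between (R : realType) (x y : \bar R) :
  (x < y)%E -> exists a : R, (x < a%:E < y)%E.
Proof.
case: x y => [x| |] [y| |] //=.
- rewrite lte_fin => xy; exists ((x + y) / 2); rewrite !lte_fin.
  by apply/andP; split; lra.
- by exists (x + 1); rewrite lte_fin ltry andbT; lra.
- by exists (y - 1); rewrite lte_fin ltNyr; lra.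
- by exists 0; rewrite ltry ltNyr.
Qed.

Section Ratio.
Context {R : realType} {L : vectorLatticeType R}.

(** Let $e \geq 0$ lie outside the prime ideal P. As $L/P$ is totally ordered,
    the real multiples of $e$ cut $L/P$, and x is the place of f in that cut,
    that is, the quotient $f/e$ computed in $L/P$ up to infinitesimals. Both
    halves of the cut are recorded, which makes the condition symmetric under
    the exchange of f and $-f$. *)
Definition mod_ratio (P : set L) (e f : L) (x : \bar R) := forall a : R,
  ((x < a%:E)%E -> mod_le P f (a *: e)) /\
  ((a%:E < x)%E -> mod_le P (a *: e) f).

Variable P : set L.
Hypothesis primeP : prime_videal P.
Let idealP : videal P := primeP.1.
Let splitP := primeP.2.
Variable e : L.
Hypotheses (e0 : 0 <= e) (Pe : ~ P e).
Implicit Types (f g h : L) (a b : R) (x y : \bar R).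

Lemma mod_leZe a b : mod_le P (a *: e) (b *: e) -> a <= b.
Proof.
move=> ab; rewrite leNgt; apply/negP => ba; apply: Pe.
have /(mod_leD idealP ab) : mod_le P (- (b *: e)) (- (b *: e)).
  exact: le_mod_le.
rewrite subrr -scalerBl -subr_gt0 in ba *.
move=> /(mod_leZ idealP (a := (a - b)^-1)).
rewrite invr_ge0 ltW// scaler0 scalerA mulVf ?gt_eqF// scale1r.
by move=> /(_ isT)/(mod_le0 P e0).
Qed.

Lemma mod_ratio_le f g x y :
  mod_le P f g -> mod_ratio P e f x -> mod_ratio P e g y -> (x <= y)%E.
Proof.
move=> fg fx gy; rewrite leNgt; apply/negP.
move=> /lte_fin_between[c /andP[yc /lte_fin_between[d /andP[cd dx]]]].
have /mod_leZe : mod_le P (d *: e) (c *: e).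
  apply: (mod_le_trans idealP ((fx d).2 dx)).
  by apply: (mod_le_trans idealP fg); exact: (gy c).1.
by rewrite leNgt -lte_fin cd.
Qed.

Lemma mod_ratio_unique f x y :
  mod_ratio P e f x -> mod_ratio P e f y -> x = y.
Proof.
move=> fx fy; have ff : mod_le P f f by exact: le_mod_le.
by apply/eqP; rewrite eq_le (mod_ratio_le ff fx fy) (mod_ratio_le ff fy fx).
Qed.

Lemma mod_ratio_inf f : mod_ratio P e f
  (ereal_inf [set a%:E | a in [set a : R | P (pospart (f - a *: e))]]).
Proof.
move=> a; split=> [/ereal_inf_lt[_ [b /= fb <-]]|ax].
  rewrite lte_fin => /ltW ba; apply: (mod_le_trans idealP fb).
  apply: le_mod_le => //.
  by rewrite -vl_subr_ge0 -scalerBl vl_scale_ge0 ?subr_ge0.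
have [fa|//] := mod_le_total idealP splitP f (a *: e).
suff : (a%:E < a%:E)%E by rewrite ltxx.
by apply: (lt_le_trans ax); apply: ereal_inf_lbound; exists a.
Qed.

Lemma mod_ratio_real a : mod_ratio P e (a *: e) a%:E.
Proof.
move=> b; rewrite !lte_fin; split=> /ltW ab; apply: le_mod_le => //;
by rewrite -vl_subr_ge0 -scalerBl vl_scale_ge0 ?subr_ge0.
Qed.

Lemma mod_ratio_join f g x y : mod_ratio P e f x -> mod_ratio P e g y ->
  mod_ratio P e (f `|` g)%O (Order.max x y).
Proof.
move=> fx gy a; rewrite gt_max lt_max; split=> [/andP[xa ya]|].
  by apply/(mod_le_join idealP); split; [exact: (fx a).1|exact: (gy a).1].
move=> /orP[/(fx a).2|/(gy a).2] ag; apply: (mod_le_trans idealP ag);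
  by apply: le_mod_le => //; first [exact: leUl|exact: leUr].
Qed.

Lemma mod_ratio_meet f g x y : mod_ratio P e f x -> mod_ratio P e g y ->
  mod_ratio P e (f `&` g)%O (Order.min x y).
Proof.
move=> fx gy a; rewrite gt_min lt_min; split=> [|/andP[ax ay]].
  by move=> /orP[/(fx a).1|/(gy a).1] ga; apply/(mod_le_meet idealP);
    tauto.
by apply: le_mod_meet => //; [exact: (fx a).2|exact: (gy a).2].
Qed.

Lemma mod_ratioN f x : mod_ratio P e f x -> mod_ratio P e (- f) (- x)%E.
Proof.
move=> fx a; rewrite lteNl lteNr -EFinN; split=> [/(fx _).2|/(fx _).1];
by move=> /mod_leN; rewrite scaleNr opprK.
Qed.

Lemma mod_ratioD f g a b : mod_ratio P e f a%:E -> mod_ratio P e g b%:E ->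
  mod_ratio P e (f + g) (a + b)%:E.
Proof.
move=> fa gb c; rewrite !lte_fin.
(* Half of the slack between c and a + b goes to each of the two summands. *)
pose d := (c - a - b) / 2; have -> : c = (a + d) + (b + d) by rewrite /d; lra.
rewrite scalerDl; split=> abc; apply: mod_leD => //.
- by apply: (fa _).1; rewrite lte_fin; lra.
- by apply: (gb _).1; rewrite lte_fin; lra.
- by apply: (fa _).2; rewrite lte_fin; lra.
- by apply: (gb _).2; rewrite lte_fin; lra.
Qed.

Lemma mod_ratioZ_gt0 a f x : 0 < a -> mod_ratio P e f x ->
  mod_ratio P e (a *: f) (a%:E * x)%E.
Proof.
move=> a0 fx c; have -> : c = a * (c / a) by rewrite mulrC divfK// gt_eqF.
rewrite EFinM !lte_pmul2l ?lte_fin// -scalerA.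
by split=> [/(fx _).1|/(fx _).2]; apply: mod_leZ => //; exact: ltW.
Qed.

Lemma mod_ratioZ a f x : mod_ratio P e f x ->
  mod_ratio P e (a *: f) (a%:E * x)%E.
Proof.
move=> fx; have [a0|a0|->] := ltgtP a 0; last 1 first.
- by rewrite mul0e scale0r -(scale0r e); exact: mod_ratio_real.
- have /mod_ratioN : mod_ratio P e (- a *: f) ((- a)%:E * x)%E.
    by apply: mod_ratioZ_gt0; rewrite ?oppr_gt0.
  by rewrite scaleNr opprK EFinN mulNe oppeK.
- exact: mod_ratioZ_gt0.
Qed.

Lemma mod_ratio_congr e' f x : mod_le P e e' -> mod_le P e' e ->
  mod_ratio P e f x -> mod_ratio P e' f x.
Proof.
move=> ee' e'e fx a; split=> [/(fx a).1 fa|/(fx a).2 af].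
  by apply: (mod_le_trans idealP fa); exact: mod_leZ_congr.
by apply: mod_le_trans af => //; exact: mod_leZ_congr.
Qed.

End Ratio.

(** * Truncations *)

Section Truncation.
Context {R : realType} {L : vectorLatticeType R}.
Implicit Types (f g u v : posCone L) (P : set L).

Variable s : posCone L -> posCone L.
Hypothesis truncs : truncation s.

Lemma trunc_le f : (s f : L) <= (f : L).
Proof. by case: truncs => _ /(_ f f)[]. Qed.

Lemma trunc_meet f g : ((f : L) `&` (s g : L))%O <= (s f : L).
Proof. by case: truncs => _ /(_ f g)[]. Qed.

Lemma trunc_mono f g : (f : L) <= (g : L) -> (s f : L) <= (s g : L).
Proof.
move=> fg; apply: le_trans (trunc_meet g f).
by rewrite lexI lexx andbT (le_trans (trunc_le f)).
Qed.

Lemma trunc_id f g : (f : L) <= (s g : L) -> s f = f :> L.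
Proof.
move=> fg; apply/eqP; rewrite eq_le trunc_le/=.
by apply: le_trans (trunc_meet f g); rewrite lexI lexx.
Qed.

Lemma pospart_sub_trunc u :
  (pospart ((u : L) - (s u : L)) : L) = (u : L) - (s u : L).
Proof. by apply: pospart_id; rewrite vl_subr_ge0 trunc_le. Qed.

Section Modulo.
Variable P : set L.
Hypothesis primeP : prime_videal P.
Let idealP : videal P := primeP.1.

(** Modulo P, u exceeds $u^{\ast}$, so the truncation has cut u off at the top
    of its range. Formally, $v^{\ast} \wedge u \leq u^{\ast}$ makes the elements
    $v^{\ast} - v^{\ast} \wedge u$ and $u - u^{\ast}$ disjoint, and the second
    one is outside P. *)
Lemma trunc_le_pistar u v : pistar s P u -> mod_le P (s v) (s u).
Proof.
move=> Pu; have vu : ((s v : L) `&` (u : L))%O <= (s u : L).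
  by rewrite meetC trunc_meet.
suff : P ((s v : L) - ((s v : L) `&` (u : L))%O).
  move=> Pvu; apply: (videal_solid idealP Pvu) => //.
  by rewrite /= leUx vl_subr_ge0 leIl andbT vl_leD// vl_leN.
have [] // := primeP.2 ((s v : L) - ((s v : L) `&` (u : L))%O)
  ((u : L) - ((s v : L) `&` (u : L))%O).
  by rewrite -vl_meetDr subrr; case: idealP.
move=> Puv; exfalso; apply: Pu.
apply: (videal_solid idealP Puv) => //.
by rewrite (le_trans (trunc_le _))// pospart_sub_trunc vl_leD// vl_leN.
Qed.

Lemma pistar_notin u : pistar s P u -> ~ P (s u).
Proof.
move=> Pu Psu; apply: (Pu); apply/(mod_le0 P) => //.
apply: (mod_le_trans idealP (trunc_le_pistar _ Pu)).
exact/mod_le0.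
Qed.

Lemma pistar_mod_ratio u v (f : L) x : pistar s P u -> pistar s P v ->
  mod_ratio P (s u) f x -> mod_ratio P (s v) f x.
Proof.
by move=> Pu Pv; apply: (mod_ratio_congr primeP (e := s u));
  exact: trunc_le_pistar.
Qed.

End Modulo.
End Truncation.

Section MultiTruncation.
Context {R : realType} {L : vectorLatticeType R}.
Variable T : set (posCone L -> posCone L).
Hypothesis multiT : multitruncation T.
Implicit Types (f g : posCone L) (P : set L) (s t : posCone L -> posCone L).

Lemma multitrunc_disjoint s t f g : T s -> T t -> s <> t ->
  ((s f : L) `&` (t g : L))%O = 0.
Proof.
move=> Ts Tt st; apply/eqP; rewrite eq_le lexI !posCone_ge0 andbT.
pose h := PosCone (vl_addr_ge0 (posCone_ge0 f) (posCone_ge0 g)).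
have fh : (f : L) <= (h : L) by rewrite /= -[leLHS]addr0 vl_leD.
have gh : (g : L) <= (h : L) by rewrite /= -[leLHS]add0r vl_leD.
rewrite -(multiT.2 s t Ts Tt st h) leI2//.
  exact: trunc_mono (multiT.1 _ Ts) _ _ fh.
exact: trunc_mono (multiT.1 _ Tt) _ _ gh.
Qed.

Lemma Vstar_notin s P : Vstar s P -> prime_videal P /\ exists f, ~ P (s f).
Proof. by move=> [f _ [[]]]; split => //; exists f. Qed.

(** Distinct truncations have disjoint ranges, so a prime ideal that avoids
    some $f^{\ast}$ contains the range of every other truncation in T. *)
Lemma multitrunc_eq s t f g P : prime_videal P -> T s -> T t ->
  ~ P (s f) -> ~ P (t g) -> s = t.
Proof.
move=> [[P0 _ _ _] splitP] Ts Tt Pf Pg; apply: contrapT => st.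
by have [] := splitP (s f : L) (t g : L); rewrite ?multitrunc_disjoint.
Qed.

Lemma Vset_notin_Vstar s f P : Vset T P -> T s -> ~ P (s f) -> Vstar s P.
Proof.
move=> [t Tt tP] Ts Pf; have [Pp [g Pg]] := Vstar_notin tP.
by rewrite (multitrunc_eq Pp Ts Tt Pf Pg).
Qed.

End MultiTruncation.

(** * Existence of values *)

Section Values.
Context {R : realType} {L : vectorLatticeType R}.

(** An ideal that is maximal among those not containing k is prime: if a and b
    are disjoint and both lie outside P, then k is bounded modulo P by a
    multiple of a and by a multiple of b, hence by the infimum of these
    multiples, which is 0. *)
Lemma maximal_videal_prime (P : set L) (k : L) : videal P -> ~ P k ->
  (forall Q, videal Q -> ~ Q k -> P `<=` Q -> P = Q) -> prime_videal P.
Proof.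
move=> idealP Pk maxP; split=> // f g Pfg.
have bound (a : L) : 0 <= a -> ~ P a ->
    exists n : nat, mod_le P (vabs k) (a *+ n).
  move=> a0 Pa; pose Q := [set x | exists n : nat, mod_le P (vabs x) (a *+ n)].
  have PQ : P `<=` Q.
    move=> x Px; exists 0%N; rewrite mulr0n; apply/(mod_le0 P (vabs_ge0 x)).
    case: idealP => _ _ _ S; apply: S Px _.
    by rewrite (vabs_ge0_id (vabs_ge0 x)).
  have Qa : Q a by exists 1%N; rewrite vabs_ge0_id//; exact: le_mod_le.
  suff idealQ : videal Q.
    by apply: contrapT => Qk; apply: Pa; rewrite (maxP Q idealQ Qk PQ).
  split.
  - by apply: PQ; case: idealP.
  - move=> x y [n xn] [m ym]; exists (n + m)%N; rewrite mulrnDr.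
    apply: mod_le_trans (mod_leD idealP xn ym) => //; apply: le_mod_le => //.
    by rewrite vabs_le opprD !vl_leD ?leUl ?leUr.
  - move=> c x [n xn]; exists (n * Num.bound `|c|)%N.
    have c0 : 0 <= (Num.bound `|c|)%:R :> R by [].
    rewrite mulrnA -scaler_nat.
    apply: mod_le_trans (mod_leZ idealP c0 xn) => //.
    apply: le_mod_le => //; have x0 := vabs_ge0 x.
    apply: (@le_trans _ _ (`|c| *: vabs x)); last first.
      rewrite -vl_subr_ge0 -scalerBl vl_scale_ge0 ?subr_ge0//.
      by rewrite ltW// archi_boundP.
    have [c0'|/ltW c0'] := leP 0 c; rewrite vabs_le -scaleNr.
      by rewrite ger0_norm// scaleNr -scalerN !vl_ge0_leZ ?leUl ?leUr.
    rewrite ler0_norm// vl_ge0_leZ ?oppr_ge0 ?leUl// andbT.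
    by rewrite -[c *: x]opprK -scalerN -scaleNr vl_ge0_leZ ?oppr_ge0 ?leUr.
  - move=> x y [n xn] yx; exists n; apply: mod_le_trans xn => //.
    exact: le_mod_le.
pose m := (f `&` g)%O.
have [Pf|/bound] := pselect (P (f - m)).
  by left; rewrite -(subrK m f); case: idealP => _ D _ _; exact: D.
rewrite vl_subr_ge0 leIl => /(_ isT)[p kp].
have [Pg|/bound] := pselect (P (g - m)).
  by right; rewrite -(subrK m g); case: idealP => _ D _ _; exact: D.
rewrite vl_subr_ge0 leIr => /(_ isT)[q kq].
exfalso; apply: Pk; case: (idealP) => P0 D _ S.
have := D _ _ kp kq; set r := (X in P X) => Pr.
apply: S Pr _; rewrite (vabs_ge0_id (f := r)); last exact: vl_addr_ge0.
have mp : ((g - m) `&` ((f - m) *+ p))%O <= 0.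
  by apply: vl_meet_le0_mulrn; rewrite ?vl_subr_ge0 ?leIl ?leIr// -vl_meetDr
    meetC subrr.
have mpq : (((f - m) *+ p) `&` ((g - m) *+ q))%O <= 0.
  apply: vl_meet_le0_mulrn; rewrite ?vl_mulrn_ge0 ?vl_subr_ge0 ?leIl ?leIr//.
  by rewrite meetC.
rewrite -[r]add0r -vl_ler_subl; apply: le_trans mpq.
rewrite lexI !vl_ler_subl /r /=; apply/andP; split.
  rewrite addrC -vl_ler_subl -[leLHS]addr0 vl_leD ?leUl//; exact: leUr.
rewrite addrC -vl_ler_subl -[leLHS]add0r vl_leD ?leUl//; exact: leUr.
Qed.

(** Zorn's lemma gives an ideal that is maximal among those not containing k;
    being prime, it is a value of k. *)
Lemma Val_exists (k : L) : k <> 0 -> exists P, Val k P.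
Proof.
move=> k0.
(* An ideal without the condition that it contains 0: the empty set then bounds
   the empty chain, and a maximal element contains 0 for being nonempty. *)
pose I := [set A : set L | [/\ forall f g, A f -> A g -> A (f + g),
  forall (a : R) f, A f -> A (a *: f),
  forall f g, A f -> vabs g <= vabs f -> A g & ~ A k]].
have idealI A : A 0 -> I A -> videal A by move=> A0 [].
have I0 : I [set 0].
  split=> [f g -> ->|a f ->|f g ->|//].
  - by rewrite /= addr0.
  - by rewrite /= scaler0.
  - rewrite (vabs_ge0_id (lexx 0)) vabs_le => /andP[g0 g1]; apply/eqP.
    by rewrite eq_le g0/= -vl_leN oppr0.
have [F FI chainF|P [IP maxP]] := @Zorn_bigcup _ I.
  have pair f g : (\bigcup_(A in F) A) f -> (\bigcup_(A in F) A) g ->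
      exists A, [/\ F A, A f & A g].
    move=> [A FA Af] [B FB Bg]; have [AB|BA] := chainF _ _ FA FB.
      by exists B; split=> //; exact: AB.
    by exists A; split=> //; exact: BA.
  split.
  - move=> f g /pair /[apply] -[A [FA Af Ag]]; exists A => //.
    by have [D _ _ _] := FI _ FA; exact: D.
  - move=> a f [A FA Af]; exists A => //.
    by have [_ D _ _] := FI _ FA; exact: D.
  - move=> f g [A FA Af] gf; exists A => //.
    by have [_ _ D _] := FI _ FA; exact: D gf.
  - by move=> [A /FI[_ _ _]].
have P0 : P 0.
  have [f Pf] : exists f, P f.
    apply: contrapT => /forallNP PN; apply: (maxP [set 0]) => //.
    by split=> [f /PN//|/(_ 0)/(_ erefl)/PN].
  by rewrite -(scale0r f); case: IP => _ S _ _; exact: S.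
have idealP := idealI _ P0 IP; have [_ _ _ Pk] := IP.
have max Q : videal Q -> ~ Q k -> P `<=` Q -> P = Q.
  move=> [_ D S U] Qk PQ; apply: contrapT => nPQ.
  by apply: (maxP Q) => //; split=> // QP; apply/nPQ/seteqP.
have primeP := maximal_videal_prime idealP Pk max.
exists P; split=> //.
  by split=> //; apply/eqP => PT; apply: Pk; rewrite PT.
by move=> Q [[idealQ _] _]; exact: max.
Qed.

End Values.

(** * Maximal multi-truncations *)

Section Maximal.
Context {R : realType} {L : vectorLatticeType R}.
Variable T : set (posCone L -> posCone L).
Hypotheses (archL : archimedean L) (maxT : maximal_multitruncation T).
Implicit Types (f g h u v : posCone L) (s t : posCone L -> posCone L).

Let multiT : multitruncation T := maxT.1.

(** If h were disjoint from the ranges of all the truncations in T, then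
    $f \mapsto f \wedge h$ could be added to T. It is a truncation because L is
    Archimedean. *)
Lemma maximal_meets h : (h : L) <> 0 ->
  exists s f, T s /\ ((h : L) `&` (s f : L))%O <> 0.
Proof.
move=> h0; apply: contrapT => none.
have disj s f : T s -> ((h : L) `&` (s f : L))%O = 0.
  by move=> Ts; apply: contrapT => hf; apply: none; exists s, f.
pose t f := pospart ((f : L) `&` (h : L))%O.
have tE f : (t f : L) = ((f : L) `&` (h : L))%O.
  by rewrite /t pospart_id// lexI !posCone_ge0.
have th : (t h : L) = h by rewrite tE meetxx.
have trunct : truncation t.
  split.
  - by exists h; apply/eqP; rewrite th.
  - move=> f g; rewrite !tE; split; last exact: leIl.
    by rewrite lexI leIl/=; apply: (le_trans (leIr _ _)); exact: leIr.
  - move=> f tf; apply: (archL (g := h)) => n.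
    by rewrite -tf tE leIr.
have tdisj s f : T s -> ((t f : L) `&` (s f : L))%O = 0.
  move=> Ts; apply/eqP; rewrite eq_le lexI !posCone_ge0 andbT -(disj s f Ts).
  by rewrite leI2// tE leIr.
apply: maxT.2; exists (T `|` [set t]).
  split=> [s [/multiT.1//|->//]|s s' [Ts|->] [Ts'|->] // ss' f].
  - exact: multiT.2.
  - by rewrite meetC; exact: tdisj.
  - exact: tdisj.
split=> [s Ts|]; first by left.
move=> /(_ t (or_intror erefl))/(disj t h).
by rewrite th meetxx.
Qed.

(** Let $k = h \wedge f^{\ast} \neq 0$. The truncation cannot fix all the
    multiples of k, so it cuts off some $v = nk$, and $v - v^{\ast}$ is not
    disjoint from $k = k^{\ast}$, because it is nonzero and bounded by $nk$. *)
Lemma maximal_cuts h : (h : L) <> 0 -> exists s v n,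
  [/\ T s, (v : L) <= (h : L) *+ n &
      (s (pospart ((v : L) - (s v : L))) : L) <> 0].
Proof.
move=> /maximal_meets[s [f [Ts hf]]]; have truncs := multiT.1 _ Ts.
pose k := pospart ((h : L) `&` (s f : L))%O.
have kE : (k : L) = ((h : L) `&` (s f : L))%O.
  by rewrite /k pospart_id// lexI !posCone_ge0.
have sk : s k = k :> L by apply: (trunc_id truncs (g := f)); rewrite kE leIr.
have [n kn] : exists n,
    (s (pospart ((k : L) *+ n.+1)) : L) <> (k : L) *+ n.+1.
  apply: contrapT => /forallNP kn; apply: hf; rewrite -kE.
  by case: truncs => _ _; apply=> n; exact: contrapT (kn n).
pose v := pospart ((k : L) *+ n.+1).
have vE : (v : L) = (k : L) *+ n.+1 by rewrite /v pospart_id// vl_mulrn_ge0.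
exists s, v, n.+1; split=> //.
  by rewrite vE vl_lerMn// kE leIl.
set d := pospart _ => sd; apply: kn; rewrite -/v -vE; apply/eqP.
have dE : (d : L) = (v : L) - (s v : L) := pospart_sub_trunc truncs v.
suff d0 : (d : L) <= 0.
  by rewrite eq_le (trunc_le truncs)/= -[leRHS]add0r -vl_ler_subl -dE.
have dv : (d : L) <= (k : L) *+ n.+1.
  by rewrite -vE dE vl_ler_subl -[leLHS]addr0 vl_leD.
rewrite -(meet_l dv); apply: vl_meet_le0_mulrn => //.
by rewrite -[leRHS]sd -sk; exact: trunc_meet.
Qed.

(** With v from [maximal_cuts], P is a value of $(v - v^{\ast})^{\ast}$. *)
Lemma spectrum_separates h : (h : L) <> 0 -> exists s v (P : spectrum T),
  [/\ T s, pistar s (\val P) v & exists n, (v : L) <= (h : L) *+ n].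
Proof.
move=> /maximal_cuts[s [v [n [Ts vn /Val_exists[P valP]]]]].
have TP : Vset T P by exists s => //; eexists; [|exact: valP].
exists s, v, (SigSub (mem_set TP)); split=> //; last by exists n.
by case: valP.
Qed.

Lemma spectrum_notin h :
  (h : L) <> 0 -> exists P : spectrum T, ~ \val P (h : L).
Proof.
move=> /spectrum_separates[s [v [P [Ts Pv [n vn]]]]]; exists P => Ph.
have [primeP _] := spectrum_prime P; have truncs := multiT.1 _ Ts.
apply: (pistar_notin truncs primeP Pv).
have := videal_mulrn primeP.1 n Ph.
move=> /(videal_solid primeP.1); apply => //.
by apply: le_trans vn; exact: trunc_le.
Qed.

End Maximal.

(** * The functions on the spectrum *)

Lemma ereal_continuous_rays (R : realType) (X : topologicalType)
    (phi : X -> \bar R) :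
  (forall a : R, open [set x | (phi x < a%:E)%E]) ->
  (forall a : R, open [set x | (a%:E < phi x)%E]) -> continuous phi.
Proof.
move=> lo hi x A; case E: (phi x) => [r| |] /=.
- rewrite /nbhs/= => /nbhs_ballP[e /= e0 reA].
  have: nbhs x ([set x | ((r - e)%:E < phi x)%E] `&`
                [set x | (phi x < (r + e)%:E)%E]).
    apply: filterI; apply: open_nbhs_nbhs; split=> //=; rewrite E lte_fin; lra.
  apply: filterS => y /=; case: (phi y) => [q| |] [] //=; rewrite !lte_fin.
  move=> re rq; apply: reA; rewrite /ball/= ltr_norml; lra.
- move=> [M [_ MA]].
  have: nbhs x [set x | (M%:E < phi x)%E].
    by apply: open_nbhs_nbhs; split=> //=; rewrite E ltry.
  by apply: filterS => y; exact: MA.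
- move=> [M [_ MA]].
  have: nbhs x [set x | (phi x < M%:E)%E].
    by apply: open_nbhs_nbhs; split=> //=; rewrite E ltNyr.
  by apply: filterS => y; exact: MA.
Qed.

Section Spectrum.
Context {R : realType} {L : vectorLatticeType R}.
Variable T : set (posCone L -> posCone L).

Lemma open_spectrumP (A : set (spectrum T)) : open A <->
  forall P, A P -> exists g : posCone L, hk_base g P /\ hk_base g `<=` A.
Proof.
split=> [[D _ <-] P [g Dg gP]|locA].
  by exists g; split=> // Q gQ; exists g.
exists [set g | hk_base g `<=` A] => //; apply/seteqP; split=> P.
  by move=> [g gA gP]; exact: gA.
by move=> /locA[g [gP gA]]; exists g.
Qed.

Lemma open_hk_base (g : posCone L) : open (hk_base g : set (spectrum T)).
Proof. by apply/open_spectrumP => P gP; exists g; split. Qed.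

End Spectrum.

Section Hat.
Context {R : realType} {L : vectorLatticeType R}.
Variable T : set (posCone L -> posCone L).
Hypotheses (archL : archimedean L) (maxT : maximal_multitruncation T).
Variable hat : L -> (spectrum T -> \bar R).
Hypothesis hatP : forall f : L, is_hat f (hat f).
Implicit Types (f g h : L) (u v : posCone L) (P Q : spectrum T).
Implicit Types (s t : posCone L -> posCone L).

Let multiT : multitruncation T := maxT.1.
Let primeP P : prime_videal (\val P) := (spectrum_prime P).1.
Let idealP P : videal (\val P) := (primeP P).1.

Lemma spectrum_pistar P : exists s u, T s /\ pistar s (\val P) u.
Proof.
have /set_mem[s Ts sP] := valP P.
by have [u Pu _] := hatP 0 Ts sP; exists s, u.
Qed.

Lemma pistar_Vstar s u P : T s -> pistar s (\val P) u -> Vstar_in T s P.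
Proof.
by move=> Ts; apply: (Vset_notin_Vstar multiT) => //; exact: set_mem (valP P).
Qed.

(** The function $\widehat f$ was computed with some element of
    $\pi^{\ast}(P)$; as all of them yield the same $u^{\ast}$ modulo P, any
    u may be used instead. *)
Lemma hat_ratio s u P f : T s -> pistar s (\val P) u ->
  mod_ratio (\val P) (s u : L) f (hat f P).
Proof.
move=> Ts Pu; have truncs := multiT.1 _ Ts.
have [v Pv ->] := hatP f Ts (pistar_Vstar Ts Pu).
apply: (pistar_mod_ratio truncs (primeP P) Pv Pu).
exact: mod_ratio_inf.
Qed.

Lemma hat_eq s u P f x : T s -> pistar s (\val P) u ->
  mod_ratio (\val P) (s u : L) f x -> hat f P = x.
Proof.
move=> Ts Pu; have Psu := pistar_notin (multiT.1 _ Ts) (primeP P) Pu.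
apply: (mod_ratio_unique (primeP P) (posCone_ge0 (s u)) Psu).
exact: hat_ratio.
Qed.

Lemma hatN f P : hat (- f) P = (- hat f P)%E.
Proof.
have [s [u [Ts Pu]]] := spectrum_pistar P.
by apply: (hat_eq Ts Pu); apply: mod_ratioN => //; exact: hat_ratio.
Qed.

(** If $b < a$ and $\widehat f(P) < b$, then $(b u^{\ast} - f)^+ \notin P$, and
    this open condition forces $\widehat f \leq b$ on the neighbourhood of P
    where $u^{\ast}$ may serve as the unit. *)
Lemma open_hat_lt f (a : R) : open [set P | (hat f P < a%:E)%E].
Proof.
apply/open_spectrumP => P /= /lte_fin_between[b /andP[/lte_fin_between[c]]].
move=> /andP[xc cb] ba; have [s [u [Ts Pu]]] := spectrum_pistar P.
have truncs := multiT.1 _ Ts.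
have fc := (hat_ratio f Ts Pu c).1 xc.
have Pb : ~ mod_le (\val P) (b *: (s u : L)) f.
  move=> /(mod_le_trans (idealP P))/(_ fc).
  have Psu := pistar_notin truncs (primeP P) Pu.
  move=> /(mod_leZe (primeP P) (posCone_ge0 _) Psu).
  by rewrite leNgt -lte_fin cb.
have [g [_ gP gQ]] := hk_base_join (T := T) I I Pu Pb.
exists g; split=> // Q /gQ[/= Qu Qb]; apply: le_lt_trans ba.
rewrite leNgt; apply/negP => bx; apply: Qb.
exact: (hat_ratio f Ts Qu b).2.
Qed.

Lemma hat_continuous f : continuous (hat f).
Proof.
apply: ereal_continuous_rays => a; first exact: open_hat_lt.
rewrite (_ : [set _ | _] = [set P : spectrum T | (hat (- f)%R P < (- a)%:E)%E]).
  exact: open_hat_lt.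
by apply/seteqP; split=> P /=; rewrite hatN EFinN lteNl oppeK.
Qed.

(** In a base set given by g, put $k = g \wedge (u - u^{\ast})^{\ast}$. As L is
    Archimedean, $nk \not\leq |f|$ for some n, and there is a point Q of the
    spectrum that avoids $(nk - |f|)^+$. It avoids k, hence g and
    $(u - u^{\ast})^{\ast}$ as well, so that modulo Q, $u^{\ast}$ is the unit
    and $|f| \leq nk \leq n u^{\ast}$. *)
Lemma hat_dense f : dense [set P | (`|hat f P|)%E != +oo%E].
Proof.
move=> O [P OP] /open_spectrumP/(_ P OP)[g [gP gO]].
have [s [u [Ts Pu]]] := spectrum_pistar P; have truncs := multiT.1 _ Ts.
pose w := s (pospart ((u : L) - (s u : L))).
pose k := pospart ((g : L) `&` (w : L))%O.
have kE : (k : L) = ((g : L) `&` (w : L))%O.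
  by rewrite /k pospart_id// lexI !posCone_ge0.
have k0 : (k : L) <> 0.
  move=> k0; have [|/gP|/Pu] // := (primeP P).2 (g : L) (w : L).
  by rewrite -kE k0; case: (idealP P).
have [n nk] : exists n : nat, ~ (k : L) *+ n.+1 <= vabs f.
  apply: contrapT => /forallNP nk; apply: k0.
  apply: (archL (g := PosCone (vabs_ge0 f))) => n /=.
  by apply: contrapT; exact: nk.
have [|Q Qk] := spectrum_notin archL maxT
    (h := pospart ((k : L) *+ n.+1 - vabs f)).
  by move=> /eqP; rewrite pospart_eq0.
have Qk' : ~ \val Q (k : L).
  move=> /(videal_mulrn (idealP Q) n.+1)/(videal_solid (idealP Q)) Qk'.
  apply: Qk.
  apply: Qk' => //; rewrite leUx; apply/andP; split; last exact: vl_mulrn_ge0.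
  by rewrite vl_ler_subl -[leLHS]addr0 vl_leD// vabs_ge0.
have Qg : hk_base g Q.
  move=> Qg; apply: Qk'; apply: (videal_solid (idealP Q) Qg) => //.
  by rewrite kE leIl.
have Qu : pistar s (\val Q) u.
  move=> Qw; apply: Qk'; apply: (videal_solid (idealP Q) Qw) => //.
  by rewrite kE leIr.
exists Q; split; first exact: gO.
have fu : mod_le (\val Q) (vabs f) (n.+1%:R *: (s u : L)).
  have [//|fk] := mod_le_total (idealP Q) (primeP Q).2
    ((k : L) *+ n.+1) (vabs f).
  apply: (mod_le_trans (idealP Q) fk); rewrite -scaler_nat.
  apply: mod_leZ => //.
  apply: (@mod_le_trans _ _ _ _ (w : L)) => //.
    by apply: le_mod_le => //; rewrite kE leIr.
  exact: trunc_le_pistar.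
have [fu1 fu2] := (mod_le_join (idealP Q) _ _ _).1 fu.
have Qsu := pistar_notin truncs (primeP Q) Qu.
have ratio_le := mod_ratio_le (primeP Q) (posCone_ge0 (s u)) Qsu.
have rn := mod_ratio_real (primeP Q) (posCone_ge0 (s u)) n.+1%:R.
have := ratio_le _ _ _ _ fu1 (hat_ratio f Ts Qu) rn.
have := ratio_le _ _ _ _ fu2 (hat_ratio (- f) Ts Qu) rn.
by rewrite /= hatN; case: (hat f Q).
Qed.

(** Otherwise, let $h = (f - g)^+ \neq 0$ and take P and $v \leq nh$ from
    [spectrum_separates]. By density there is a point Q at which v still gives
    the unit $v^{\ast}$ and $\widehat f = \widehat g$ is finite, so that h has
    ratio 0 to $v^{\ast}$ modulo Q; but $v^{\ast} \leq v \leq nh$. *)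
Lemma hat_inj_le f g : hat f = hat g -> f <= g.
Proof.
move=> fg; apply: contrapT => nfg; pose h := pospart (f - g).
have [|s [v [P [Ts Pv [n vn]]]]] := spectrum_separates archL maxT (h := h).
  by move=> /eqP; rewrite pospart_eq0.
have [|Q [Qv]] := hat_dense f _
    (open_hk_base T (s (pospart ((v : L) - (s v : L))))).
  by exists P.
have truncs := multiT.1 _ Ts; have Qsv := pistar_notin truncs (primeP Q) Qv.
have := hat_ratio f Ts Qv; have := hat_ratio g Ts Qv; rewrite -fg /=.
case: (hat f Q) => [r| |] // gr fr _.
have hr : mod_ratio (\val Q) (s v : L) (h : L) 0%:E.
  rewrite -(maxxx 0%:E) /h /=; apply: (mod_ratio_join (primeP Q)).
    by rewrite -(subrr r); apply: (mod_ratioD (primeP Q) fr);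
    exact: (mod_ratioN gr).
  rewrite -(scale0r (s v : L)).
  exact: (mod_ratio_real (primeP Q) (posCone_ge0 (s v))).
have := mod_ratioZ (primeP Q) (posCone_ge0 (s v)) n%:R hr; rewrite mule0 => nhr.
have sv1 := mod_ratio_real (primeP Q) (posCone_ge0 (s v)) 1.
rewrite scale1r in sv1.
suff svnh : mod_le (\val Q) (s v : L) (n%:R *: (h : L)).
  have := mod_ratio_le (primeP Q) (posCone_ge0 (s v)) Qsv svnh sv1 nhr.
  by rewrite lee_fin ler10.
apply: le_mod_le => //; rewrite scaler_nat; apply: le_trans vn.
exact: trunc_le.
Qed.

Lemma hat_inj : injective hat.
Proof.
by move=> f g fg; apply/eqP; rewrite eq_le !hat_inj_le.
Qed.

Lemma hatD f g P : hat f P \is a fin_num -> hat g P \is a fin_num ->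
  hat (f + g) P = (hat f P + hat g P)%E.
Proof.
have [s [u [Ts Pu]]] := spectrum_pistar P.
have := hat_ratio f Ts Pu; have := hat_ratio g Ts Pu.
case: (hat f P) => // a; case: (hat g P) => // b gb fa _ _.
by apply: (hat_eq Ts Pu); rewrite -EFinD; exact: mod_ratioD.
Qed.

Lemma hatZ a f P : hat (a *: f) P = (a%:E * hat f P)%E.
Proof.
have [s [u [Ts Pu]]] := spectrum_pistar P.
by apply: (hat_eq Ts Pu); apply: mod_ratioZ => //; exact: hat_ratio.
Qed.

Lemma hat_join f g P : hat (f `|` g)%O P = Order.max (hat f P) (hat g P).
Proof.
have [s [u [Ts Pu]]] := spectrum_pistar P.
by apply: (hat_eq Ts Pu); apply: mod_ratio_join => //; exact: hat_ratio.
Qed.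

Lemma hat_meet f g P : hat (f `&` g)%O P = Order.min (hat f P) (hat g P).
Proof.
have [s [u [Ts Pu]]] := spectrum_pistar P.
by apply: (hat_eq Ts Pu); apply: mod_ratio_meet => //; exact: hat_ratio.
Qed.

Lemma hat0 P : hat 0 P = 0%E.
Proof. by rewrite -(scale0r (0 : L)) hatZ mul0e. Qed.

Lemma hat_le f g P : mod_le (\val P) f g -> (hat f P <= hat g P)%E.
Proof.
have [s [u [Ts Pu]]] := spectrum_pistar P => fg.
have Psu := pistar_notin (multiT.1 _ Ts) (primeP P) Pu.
exact: (mod_ratio_le (primeP P) (posCone_ge0 (s u)) Psu fg
  (hat_ratio f Ts Pu) (hat_ratio g Ts Pu)).
Qed.

Lemma hat_trunc_in s v P : T s -> Vstar_in T s P ->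
  hat (s v) P = Order.min 1%E (hat v P).
Proof.
move=> Ts sP; have [u Pu _] := hatP 0 Ts sP; have truncs := multiT.1 _ Ts.
have <- : hat (s u) P = 1%E.
  apply: (hat_eq Ts Pu); rewrite -[X in mod_ratio _ _ X]scale1r.
  exact: mod_ratio_real.
rewrite -hat_meet; apply/eqP; rewrite eq_le; apply/andP; split; apply: hat_le.
  apply: (le_mod_meet (idealP P) (primeP P).2).
    exact: (trunc_le_pistar truncs (primeP P)).
  by apply: le_mod_le => //; exact: trunc_le.
by apply: le_mod_le => //; rewrite meetC; exact: trunc_meet.
Qed.

Lemma hat_trunc_notin s v P : T s -> ~ Vstar_in T s P -> hat (s v) P = 0%E.
Proof.
move=> Ts sP; have Psv : \val P (s v : L).
  apply: contrapT => Psv; apply: sP.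
  by apply: (Vset_notin_Vstar multiT) Ts Psv; exact: set_mem (valP P).
rewrite -(hat0 P); apply/eqP; rewrite eq_le; apply/andP; split; apply: hat_le.
  exact/(mod_le0 _ (posCone_ge0 (s v))).
exact: le_mod_le.
Qed.

Lemma open_Vstar s : T s -> open (Vstar_in T s).
Proof.
move=> Ts; apply/open_spectrumP => P sP.
have [_ [f Pf]] := Vstar_notin sP; exists (s f); split=> // Q Qf.
by apply: (Vset_notin_Vstar multiT) Ts Qf; exact: set_mem (valP Q).
Qed.

Lemma Vstar_in_eq s t P : T s -> T t -> Vstar_in T s P -> Vstar_in T t P ->
  s = t.
Proof.
move=> Ts Tt /Vstar_notin[Pp [f Pf]] /Vstar_notin[_ [g Pg]].
exact: (multitrunc_eq multiT Pp Ts Tt Pf Pg).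
Qed.

(** The sets $\mathcal{V}^{\ast}$ partition the spectrum into open sets, so the
    indicator of one of them is locally constant. *)
Lemma indic_Vstar_cinf s : T s ->
  (fun P => (\1_(Vstar_in T s) P)%:E : \bar R) \in @cinf_set R (spectrum T).
Proof.
move=> Ts; apply/mem_set; split; last first.
  by move=> O [P OP] _; exists P.
move=> P A /nbhs_singleton AP.
have /set_mem[t Tt tP] := valP P.
have : nbhs P (Vstar_in T t).
  by apply: open_nbhs_nbhs; split=> //; exact: open_Vstar.
apply: filterS => Q tQ; rewrite /= !indicE in AP *.
suff -> : (Q \in Vstar_in T s) = (P \in Vstar_in T s) by [].
by apply/idP/idP => /set_mem sP; apply/mem_set;
  [rewrite (Vstar_in_eq Ts Tt sP tQ)|rewrite (Vstar_in_eq Ts Tt sP tP)].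
Qed.

End Hat.

Theorem corollary5p2 (R : realType) (L : vectorLatticeType R)
    (T : set (posCone L -> posCone L))
    (hat : L -> (spectrum T -> \bar R)) :
  archimedean L ->
  maximal_multitruncation T ->
  (forall f : L, is_hat f (hat f)) ->
  exists Lambda : L -> Cinf R (spectrum T),
    [/\ forall f : L, Lambda f = hat f :> (spectrum T -> \bar R),
        injective Lambda,
        cinf_lattice_hom Lambda
      & forall s : posCone L -> posCone L, T s ->
          exists2 one : Cinf R (spectrum T),
            forall P : spectrum T, one P = (\1_(Vstar_in T s) P)%:E
          & forall f : posCone L,
              Lambda (s f) = (one `&` Lambda f)%O].
Proof.
move=> archL maxT hatP.
have cinf_hat f : hat f \in @cinf_set R (spectrum T).
  apply/mem_set; split; first exact: (hat_continuous maxT hatP).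
  exact: (hat_dense archL maxT hatP).
exists (fun f => MkCinf (cinf_hat f)); split=> //.
- move=> f g /(congr1 (@cinf_fun _ _)) /=; exact: (hat_inj archL maxT hatP).
- split=> [f g P|a f P|f g|f g] /=.
  + exact: (hatD maxT hatP).
  + exact: (hatZ maxT hatP).
  + by apply/val_inj/funext => P /=; exact: (hat_join maxT hatP).
  + by apply/val_inj/funext => P /=; exact: (hat_meet maxT hatP).
move=> s Ts; exists (MkCinf (indic_Vstar_cinf maxT Ts)) => // f.
apply/val_inj/funext => P /=; rewrite indicE.
have [sP|sP] := pselect (Vstar_in T s P).
  by rewrite mem_set//; exact: (hat_trunc_in maxT hatP).
have f0 : (0 <= hat f P)%E.
  rewrite -(hat0 maxT hatP P); apply: (hat_le maxT hatP).
  by apply: le_mod_le => //; have [[]] := spectrum_prime P.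
by rewrite memNset// (hat_trunc_notin maxT hatP f Ts sP) min_l.
Qed.
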